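(* Let $G=(V,E)$ be an undirected connected graph, $S\subset V$, and $|S|=3$. Then $S$ is not a minimal perfect critical set.
   Context: Graphs are finite, simple, undirected and unweighted. The Laplacian of $G$ is $\mathbf{L}=\Delta-D$, with $\Delta$ the diagonal matrix of vertex degrees and $D$ the adjacency matrix. For a vector $\mathbf{y}$ indexed by $V$, $\mathbf{y}_T$ is its restriction to $T\subseteq V$. A nonempty set $S\subseteq V$ is a perfect critical set (PCS) if there is an eigenvector $\mathbf{y}$ of $\mathbf{L}$ with $\mathbf{y}_{V\setminus S}=\mathbf{0}$ and $\mathbf{y}_v\neq 0$ for all $v\in S$. $S$ is a minimal perfect critical set (MPCS) if it is a PCS and no proper subset of it is a PCS. *)

(* Defs.v *)
(* Mathematical Components, with [R : realType] for the field of real numbers *)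
From HB Require Import structures.
From mathcomp Require Import all_boot all_order all_algebra.
From mathcomp Require Import reals.

Set Implicit Arguments.
Unset Strict Implicit.
Unset Printing Implicit Defensive.

Import Order.TTheory GRing.Theory Num.Theory.
Local Open Scope ring_scope.

(* A finite simple undirected graph is a finType V of vertices together with a
   symmetric irreflexive adjacency relation e. *)
Definition simple_graph (V : finType) (e : rel V) : Prop :=
  symmetric e /\ irreflexive e.

Definition connected_graph (V : finType) (e : rel V) : Prop :=
  forall u v : V, connect e u v.

Definition degree (V : finType) (e : rel V) (v : V) : nat :=
  #|[set w | e v w]|.

(* Matrices and vectors indexed by V are matrices of size #|V|; the row or
   column of a vertex v is [enum_rank v], with inverse [enum_val]. *)
Definition degree_mx (R : realType) (V : finType) (e : rel V) : 'M[R]_#|V| :=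
  diag_mx (\row_i (degree e (enum_val i))%:R).

Definition adjacency_mx (R : realType) (V : finType) (e : rel V) :
    'M[R]_#|V| :=
  \matrix_(i, j) (e (enum_val i) (enum_val j))%:R.

Definition laplacian (R : realType) (V : finType) (e : rel V) : 'M[R]_#|V| :=
  degree_mx R e - adjacency_mx R e.

Definition ventry (R : realType) (V : finType) (y : 'cV[R]_#|V|) (v : V) : R :=
  y (enum_rank v) 0.

(* Column (right) eigenvectors, whereas [eigenvalue] and [eigenspace] of
   mxalgebra use row vectors; for the symmetric Laplacian of an undirected graph
   the two agree up to transposition. *)
Definition eigenvector (R : realType) (n : nat) (A : 'M[R]_n) (y : 'cV[R]_n) :
    Prop :=
  y != 0 /\ exists a : R, A *m y = a *: y.

Definition perfect_critical_set (R : realType) (V : finType) (e : rel V)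
    (S : {set V}) : Prop :=
  S != set0 /\
  exists y : 'cV[R]_#|V|,
    [/\ eigenvector (laplacian R e) y,
        forall v, v \notin S -> ventry y v = 0
      & forall v, v \in S -> ventry y v != 0].

Definition minimal_perfect_critical_set (R : realType) (V : finType)
    (e : rel V) (S : {set V}) : Prop :=
  perfect_critical_set R e S /\
  forall S' : {set V}, S' \proper S -> ~ perfect_critical_set R e S'.

(* Main.v *)
Require Import Defs.
From HB Require Import structures.
From mathcomp Require Import all_boot all_order all_algebra.
From mathcomp Require Import ring lra.
From mathcomp Require Import reals.

(** Let [y] be an eigenvector, for the eigenvalue [a], with support
    S = {p, q, r}.  The key claim is that a vertex [v] outside S is adjacent to
    all of S or to none of it.  The eigenvector equation at [v] says that the
    values of [y] on the neighbours of [v] in S add up to 0.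
    - If [a] is nonzero, then [y] sums to 0, because the Laplacian kills the
      total sum ([laplacian_sum0]).  One neighbour in S would give a zero entry
      in S; two neighbours would have opposite values, so that the third vertex
      of S would carry a zero entry.
    - If [a = 0], the Dirichlet form of [y] vanishes, so [y] is constant along
      edges ([laplacian_ker_edge]) and no edge leaves S.

    Of the three pairs in S two have the same adjacency status, so two vertices
    of S are joined in the same way to the third one, hence to every vertex
    other than themselves.  For such twins [u], [w], the difference of the two
    indicator vectors is an eigenvector ([twins_perfect_critical]), so {u, w} is
    a perfect critical set properly contained in S. *)

Import Order.TTheory GRing.Theory Num.Theory.

Section Laplacian.

Set Implicit Arguments.
Unset Strict Implicit.
Unset Printing Implicit Defensive.
Local Open Scope ring_scope.

(** In a vanishing sum of three nonzero terms, a proper nonempty partial sum is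
    a nonzero term or the opposite of one. *)
Lemma zero_subsum3 (R : realType) (x y z : R) (b1 b2 b3 : bool) :
  x != 0 -> y != 0 -> z != 0 -> x + y + z = 0 ->
  b1%:R * x + b2%:R * y + b3%:R * z = 0 -> b1 = b2 /\ b2 = b3.
Proof.
move=> /eqP xN0 /eqP yN0 /eqP zN0 sum0.
by case: b1 b2 b3 => [] [] [] //=; rewrite ?mulr1n ?mulr0n => sub0; exfalso;
  solve [apply: xN0; lra | apply: yN0; lra | apply: zN0; lra].
Qed.

Variables (R : realType) (V : finType) (e : rel V).
Implicit Types (y : 'cV[R]_#|V|) (u v w : V).

Lemma degreeE v : (degree e v)%:R = \sum_w (e v w)%:R :> R.
Proof.
rewrite /degree -sum1_card natr_sum big_mkcond /=.
by apply: eq_bigr => w _; rewrite inE; case: (e v w).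
Qed.

Lemma ventry_laplacian y v :
  ventry (laplacian R e *m y) v =
  \sum_w (e v w)%:R * (ventry y v - ventry y w).
Proof.
rewrite /ventry /laplacian /degree_mx /adjacency_mx mulmxBl mul_diag_mx !mxE.
rewrite enum_rankK degreeE mulr_suml.
rewrite [X in _ - X](reindex _ (onW_bij _ (@enum_rank_bij V))) /= -sumrB.
by apply: eq_bigr => w _; rewrite !mxE !enum_rankK mulrBr.
Qed.

Lemma ventry_inj y z : (forall v, ventry y v = ventry z v) -> y = z.
Proof.
move=> yz; apply/colP => i.
by have := yz (enum_val i); rewrite /ventry enum_valK.
Qed.

Hypothesis e_sym : symmetric e.

Lemma laplacian_sum0 y : \sum_v ventry (laplacian R e *m y) v = 0.
Proof.
set s := LHS; suff: s = - s by move=> h; lra.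
rewrite /s (eq_bigr _ (fun v _ => ventry_laplacian y v)) {1}exchange_big /=.
rewrite -sumrN; apply: eq_bigr => v _; rewrite -sumrN; apply: eq_bigr => w _.
by rewrite e_sym; ring.
Qed.

(** Summation by parts; the factor 2 arises because the left-hand side counts
    each edge in both orientations. *)
Lemma dirichlet_form y :
  \sum_v \sum_w (e v w)%:R * (ventry y v - ventry y w) ^+ 2 =
  2 * \sum_v ventry y v * ventry (laplacian R e *m y) v.
Proof.
under [in RHS]eq_bigr => v _ do rewrite ventry_laplacian mulr_sumr.
rewrite mulr_natl mulr2n [X in _ + X]exchange_big -big_split; apply: eq_bigr => v _ /=.
rewrite -big_split; apply: eq_bigr => w _ /=; rewrite [e w v]e_sym; ring.
Qed.

Lemma laplacian_ker_edge y u w :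
  laplacian R e *m y = 0 -> e u w -> ventry y u = ventry y w.
Proof.
move=> Ly0 euw; have := dirichlet_form y; rewrite Ly0.
rewrite [X in 2 * X]big1 => [|v _]; last by rewrite /ventry mxE mulr0.
have term_ge0 v x : 0 <= (e v x)%:R * (ventry y v - ventry y x) ^+ 2 :> R.
  by rewrite mulr_ge0 ?ler0n ?sqr_ge0.
rewrite mulr0 => /psumr_eq0P sum0.
have /psumr_eq0P row0 := sum0 (fun v _ => sumr_ge0 _ (fun x _ => term_ge0 v x)) u isT.
have /eqP := row0 (fun x _ => term_ge0 u x) w isT.
by rewrite euw mul1r sqrf_eq0 subr_eq0 => /eqP.
Qed.

Hypothesis e_irr : irreflexive e.

(** The difference of the indicators of [u] and [w] is an eigenvector: the two
    contributions cancel at every other vertex, and [u] and [w] have the same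
    degree, whence the eigenvalue [degree e u + e u w]. *)
Lemma twins_perfect_critical u w :
  u != w -> (forall x, x != u -> x != w -> e u x = e w x) ->
  perfect_critical_set R e [set u; w].
Proof.
move=> neq_uw twins; split; first by apply/set0Pn; exists u; rewrite set21.
pose y : 'cV[R]_#|V| :=
  \col_i ((enum_val i == u)%:R - (enum_val i == w)%:R).
have yE v : ventry y v = (v == u)%:R - (v == w)%:R.
  by rewrite /ventry mxE enum_rankK.
have neq_wu : (w == u) = false by rewrite eq_sym; apply: negbTE.
have yu : ventry y u = 1 by rewrite yE eqxx (negbTE neq_uw) subr0.
have deg_uw : (degree e w)%:R = (degree e u)%:R :> R.
  rewrite !degreeE (bigD1 u) //= (bigD1 w) //= 1?eq_sym //.
  rewrite [RHS](bigD1 u) //= [in RHS](bigD1 w) //= 1?eq_sym //.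
  rewrite !e_irr !add0r [e w u]e_sym; congr (_ + _).
  by apply: eq_bigr => x /andP[xu xw]; rewrite twins.
exists y; split.
- split; first by apply: contraTneq isT => y0; move: yu; rewrite y0 /ventry mxE; lra.
  exists ((degree e u)%:R + (e u w)%:R); apply: ventry_inj => v.
  rewrite ventry_laplacian.
  have -> : \sum_x (e v x)%:R * (ventry y v - ventry y x) =
            (degree e v)%:R * ventry y v - ((e v u)%:R - (e v w)%:R).
    have pick z : \sum_x (e v x)%:R * (x == z)%:R = (e v z)%:R :> R.
      rewrite (bigD1 z) //= eqxx mulr1 big1 ?addr0 // => x /negbTE ->.
      by rewrite mulr0.
    rewrite degreeE mulr_suml -(pick u) -(pick w) -!sumrB.
    by apply: eq_bigr => x _; rewrite mulrBr (yE x) mulrBr.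
  have -> : ventry (((degree e u)%:R + (e u w)%:R) *: y) v =
            ((degree e u)%:R + (e u w)%:R) * ventry y v by rewrite /ventry mxE.
  rewrite yE; have [-> | vu] := eqVneq v u.
    by rewrite (negbTE neq_uw) e_irr mulr1n mulr0n; ring.
  have [-> | vw] := eqVneq v w.
    by rewrite deg_uw e_irr [e w u]e_sym mulr1n mulr0n; ring.
  by rewrite [e v u]e_sym [e v w]e_sym twins // mulr0n; ring.
- by move=> v; rewrite !inE negb_or yE => /andP[/negbTE -> /negbTE ->]; rewrite subr0.
- move=> v; rewrite !inE yE => /orP[]/eqP->.
    by rewrite eqxx (negbTE neq_uw) subr0 oner_eq0.
  by rewrite eqxx neq_wu sub0r oppr_eq0 oner_eq0.
Qed.

(** For [a = 0] no edge leaves the triple; otherwise the neighbours of [v] in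
    the triple and the whole triple both carry sum 0, and [zero_subsum3]
    applies. *)
Lemma critical_triple_uniform (p q r : V) y (a : R) :
  uniq [:: p; q; r] ->
  laplacian R e *m y = a *: y ->
  (forall v, v \notin [:: p; q; r] -> ventry y v = 0) ->
  (forall v, v \in [:: p; q; r] -> ventry y v != 0) ->
  forall v, v \notin [:: p; q; r] -> e p v = e q v /\ e q v = e r v.
Proof.
move=> S_uniq Ly y0 yN0 v vS.
have sumS (f : V -> R) : (forall x, x \notin [:: p; q; r] -> f x = 0) ->
    \sum_x f x = f p + f q + f r.
  move=> f0; rewrite (bigID (mem [:: p; q; r])) /= [X in _ + X]big1 // addr0.
  by rewrite -big_uniq //= !big_cons big_nil addr0 addrA.
have yp : ventry y p != 0 by apply: yN0; rewrite !inE eqxx.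
have yq : ventry y q != 0 by apply: yN0; rewrite !inE eqxx orbT.
have yr : ventry y r != 0 by apply: yN0; rewrite !inE eqxx !orbT.
have [a0 | aN0] := eqVneq a 0.
  have eSv s : ventry y s != 0 -> e s v = false.
    move=> ys; apply: contraNF ys => esv.
    by rewrite (laplacian_ker_edge _ esv) ?y0 // Ly a0 scale0r.
  by rewrite !eSv.
have ventryZ x : ventry (a *: y) x = a * ventry y x by rewrite /ventry mxE.
have sum_y : ventry y p + ventry y q + ventry y r = 0.
  apply/(mulfI aN0); rewrite -(sumS (ventry y)) // mulr_sumr mulr0 -[RHS](laplacian_sum0 y) Ly.
  by apply: eq_bigr => x _; rewrite ventryZ.
apply: (zero_subsum3 yp yq yr) => //.
have := ventry_laplacian y v; rewrite Ly ventryZ y0 // mulr0 sumS => [|x xS].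
  by move/esym/eqP; rewrite !sub0r !mulrN -!opprD oppr_eq0 ![e v _]e_sym => /eqP.
by rewrite y0 // subr0 mulr0.
Qed.

End Laplacian.

Theorem theorem2 (R : realType) (V : finType) (e : rel V)
  (e_simple : simple_graph e) (e_connected : connected_graph e)
  (S : {set V}) (S_card : #|S| = 3) :
  ~ minimal_perfect_critical_set R e S.
Proof.
case: e_simple => e_sym e_irr [[_ [y [[_ [a Ly]] y0 yN0]]] S_min].
have [p [q [r [S_uniq memS]]]] :
    exists p q r, uniq [:: p; q; r] /\ S =i [:: p; q; r].
  have := enum_uniq S; have := mem_enum S; move: S_card; rewrite cardE.
  case: (enum S) => [|p [|q [|r [|]]]] // _ memS S_uniq.
  by exists p, q, r; split=> // x; rewrite -memS.
have uniform v : v \notin S -> e p v = e q v /\ e q v = e r v.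
  rewrite memS; apply: (critical_triple_uniform e_sym S_uniq Ly) => x.
    by rewrite -memS; apply: y0.
  by rewrite -memS; apply: yN0.
have not_twins u w : u \in S -> w \in S -> u != w ->
    ~ (forall x, x != u -> x != w -> e u x = e w x).
  move=> uS wS uw /(twins_perfect_critical R e_sym e_irr uw); apply: S_min.
  rewrite properEcard S_card cards2 uw andbT.
  by apply/subsetP => x /set2P[] ->.
have [pS qS rS] : [/\ p \in S, q \in S & r \in S].
  by rewrite !memS !inE !eqxx !orbT.
move: (S_uniq); rewrite /= !inE negb_or andbT => /andP[/andP[pq pr] qr].
have split_S (P : V -> Prop) :
    (forall v, v \notin S -> P v) -> P p -> P q -> P r -> forall v, P v.
  move=> PC Pp Pq Pr v; have [|/PC //] := boolP (v \in S).
  by rewrite memS !inE => /or3P[] /eqP ->.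
have [epq_epr | ne1] := eqVneq (e p q) (e p r).
  apply: (not_twins q r) => //; apply: split_S => [v /uniform[] //||/eqP //|_ /eqP //].
  by rewrite ![e _ p]e_sym.
have [epq_eqr | ne2] := eqVneq (e p q) (e q r).
  apply: (not_twins p r) => //; apply: split_S => [v /uniform[-> ] //|/eqP //||_ /eqP //].
  by rewrite [e r q]e_sym.
apply: (not_twins p q) => //; apply: split_S => [v /uniform[] //|/eqP //|_ /eqP //|].
by move: ne1 ne2; case: (e p q); case: (e p r); case: (e q r).
Qed.
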